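(* Let $\mathcal F$ be a division ring with an involutive anti-automorphism $*$ and of characteristic different from $2$. Let $A\in\mathcal F^{m\times p}$, $B\in\mathcal F^{m\times q}$, $C\in\mathcal F^{s\times p}$, $D\in\mathcal F^{t\times p}$, $\Phi=\Phi^*\in\mathcal F^{m\times m}$, $\Psi=\Psi^*\in\mathcal F^{s\times s}$, $\Omega=\Omega^*\in\mathcal F^{t\times t}$ be given. The system of matrix equations $$AXA^*+BY+(BY)^*=\Phi,\qquad CXC^*=\Psi,\qquad DXD^*=\Omega,\qquad X=X^*$$ has a solution $(X,Y)\in\mathcal F^{p\times p}\times\mathcal F^{q\times m}$ if and only if all of the following rank equalities hold: $$\mathrm{r}\begin{pmatrix}\Phi&A&B\\ B^*&0&0\end{pmatrix}=\mathrm{r}(A,B)+\mathrm{r}(B),\quad \mathrm{r}(C,\Psi)=\mathrm{r}(C),\quad \mathrm{r}(D,\Omega)=\mathrm{r}(D),$$ $$\mathrm{r}\begin{pmatrix}\Phi&0&A&B\\ 0&-\Psi&C&0\\ A^*&C^*&0&0\\ B^*&0&0&0\end{pmatrix}=2\,\mathrm{r}\begin{pmatrix}A&B\\ C&0\end{pmatrix},\quad \mathrm{r}\begin{pmatrix}\Phi&0&A&B\\ 0&-\Omega&D&0\\ A^*&D^*&0&0\\ B^*&0&0&0\end{pmatrix}=2\,\mathrm{r}\begin{pmatrix}A&B\\ D&0\end{pmatrix},$$ $$\mathrm{r}\begin{pmatrix}\Psi&0&C\\ 0&-\Omega&D\\ C^*&D^*&0\end{pmatrix}=2\,\mathrm{r}\begin{pmatrix}C\\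 D\end{pmatrix},$$ $$\mathrm{r}\begin{pmatrix}\Phi&0&0&A&A&B\\ 0&-\Psi&0&C&0&0\\ 0&0&-\Omega&0&D&0\\ A^*&C^*&D^*&0&0&0\\ B^*&0&0&0&0&0\end{pmatrix}=\mathrm{r}\begin{pmatrix}A&A&B\\ C&0&0\\ 0&D&0\end{pmatrix}+\mathrm{r}\begin{pmatrix}A&B\\ C&0\\ D&0\end{pmatrix}.$$
   Context: $\mathcal F^{m\times n}$ is the set of $m\times n$ matrices over $\mathcal F$. For a matrix $A$ over $\mathcal F$, $A^*$ is its conjugate transpose: the transpose with the involutive anti-automorphism $*$ of $\mathcal F$ applied to each entry. The rank $\mathrm{r}(\cdot)$ of a matrix over $\mathcal F$ is the dimension of its left row space, equal to the dimension of its right column space. Blocks $0$ denote zero blocks of the appropriate size. *)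

(* Defs.v *)
From HB Require Import structures.
From mathcomp Require Import all_boot all_order all_algebra.
From mathcomp Require Import boolp classical_sets.

Set Implicit Arguments.
Unset Strict Implicit.
Unset Printing Implicit Defensive.

Import GRing.Theory.
Local Open Scope ring_scope.
Local Open Scope classical_set_scope.

(* [GRing.field_axiom] only says that nonzero elements are units; commutativity
   is not assumed in a [unitRingType]. *)
Definition division_ring (F : unitRingType) : Prop := GRing.field_axiom F.

Definition involutive_antiautomorphism (F : nzRingType) (star : F -> F) : Prop :=
  [/\ star 1 = 1,
      forall x y : F, star (x + y) = star x + star y,
      forall x y : F, star (x * y) = star y * star x
    & involutive star].

Definition conjtr (F : nzRingType) (star : F -> F) (m n : nat)
    (A : 'M[F]_(m, n)) : 'M[F]_(n, m) := map_mx star A^T.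

Definition left_row_space (F : nzRingType) (m n : nat) (A : 'M[F]_(m, n)) :
    set 'rV[F]_n := [set u *m A | u in [set: 'rV[F]_m]].

(* The library's [row_free] and [\rank] are restricted to commutative fields. *)
Definition left_row_free (F : nzRingType) (r n : nat) (V : 'M[F]_(r, n)) : Prop :=
  forall u : 'rV[F]_r, u *m V = 0 -> u = 0.

Definition left_row_basis (F : nzRingType) (m n r : nat)
    (A : 'M[F]_(m, n)) (V : 'M[F]_(r, n)) : Prop :=
  left_row_free V /\ left_row_space V = left_row_space A.

(* The size of a basis of the left row space.  Over a division ring such a basis
   exists and its size is unique, so the default value 0 is never taken. *)
Definition rk (F : nzRingType) (m n : nat) (A : 'M[F]_(m, n)) : nat :=
  xget 0%N [set r | exists V : 'M[F]_(r, n), left_row_basis A V].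

(* Main.v *)
(* Over a division ring, [rk (block_mx M P Q 0) = rk P + rk Q] says exactly that
   x M y = 0 whenever x P = 0 and Q y = 0, so every rank condition is a statement about
   vectors.  If the rows of N span the left kernel of B, then eliminating Y turns the first
   equation into (N A) X (N A)^* = N Phi N^* (halving a hermitian matrix is where the
   characteristic enters).  A hermitian X is then a hermitian form prescribed on the row
   spaces U1, U2, U3 of N A, C, D; the rank conditions say that the three forms are well
   defined, agree on pairwise intersections, and satisfy
   h1(u2 + u3, c) = h2(u2, c) + h3(u3, c) for c in all three spaces and u2 + u3 in U1.
   Forms on U2 + U3 extending h2 and h3 can be adjusted to agree with h1 on
   U1 meet (U2 + U3), and forms on two subspaces agreeing on the intersection glue. *)
Require Import Defs.
From HB Require Import structures.
From mathcomp Require Import all_boot all_order all_algebra.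
From mathcomp Require Import boolp classical_sets.

Set Implicit Arguments.
Unset Strict Implicit.
Unset Printing Implicit Defensive.

Import GRing.Theory.
Local Open Scope ring_scope.

Lemma col_mx_row_mx (R : Type) m1 m2 n1 n2 (A : 'M[R]_(m1, n1)) (B : 'M_(m1, n2))
    (C : 'M_(m2, n1)) (D : 'M_(m2, n2)) :
  col_mx (row_mx A B) (row_mx C D) = row_mx (col_mx A C) (col_mx B D).
Proof. by rewrite -block_mxEv block_mxEh. Qed.

(** * Rank over a division ring through one-sided inverses *)

Section DivisionRingRank.

Variables (F : unitRingType) (divF : division_ring F).

Let unit_neq0 (x : F) : x != 0 -> x \is a GRing.unit.
Proof. exact: divF. Qed.

(** Gaussian elimination on the first column: if it vanishes, one row is discarded; otherwise a
    pivot row clears it. Either way the induction hypothesis applies with one row and one column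
    fewer. *)
Lemma left_row_dependent n (V : 'M[F]_(1 + n, n)) :
  exists2 u : 'rV_(1 + n), u != 0 & u *m V = 0.
Proof.
elim: n V => [|n IHn]; first by exists 1%:M; [exact: oner_neq0 | exact: thinmx0].
change (forall V : 'M[F]_(1 + (1 + n), 1 + n),
  exists2 u : 'rV_(1 + (1 + n)), u != 0 & u *m V = 0) => V.
rewrite -[V]hsubmxK; move: (lsubmx V) (rsubmx V) => v W.
have [j v_j|v0] := pickP (fun j => v j 0 != 0); last first.
  have [u u0 uW] := IHn (dsubmx W).
  exists (row_mx 0 u); first by rewrite row_mx_eq0 negb_and u0 orbT.
  rewrite (_ : v = 0); last first.
    by apply/colP => i; have /negbFE/eqP -> := v0 i; rewrite [RHS]mxE.
  by rewrite mul_mx_row mulmx0 -[W]vsubmxK mul_row_col mul0mx add0r uW row_mx0.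
(* The rows of [N] subtract from each row other than [j] the multiple of row [j] that clears [v].
   Its columns other than [j] form the identity, so [u *m N] vanishes only with [u]. *)
pose N : 'M_(1 + n, 1 + (1 + n)) :=
  rowsub (lift j) (1%:M - v *m ((v j 0)^-1 *: delta_mx 0 j)).
have Nv : N *m v = 0.
  have pivot : (v j 0)^-1 *: row j v = 1%:M.
    by apply/matrixP => i k; rewrite !ord1 !mxE eqxx mulVr // unit_neq0.
  rewrite mul_rowsub_mx mulmxBl mul1mx -mulmxA -scalemxAl -rowE pivot mulmx1 subrr.
  by apply/matrixP => i k; rewrite !mxE.
have Nl : colsub (lift j) N = 1%:M.
  apply/matrixP => i k; rewrite !mxE (inj_eq lift_inj) big1 ?subr0 // => l _.
  by rewrite !mxE [_ == j]eq_sym (negPf (neq_lift _ _)) andbF !mulr0.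
have [u u0 uNW] := IHn (N *m W).
exists (u *m N); last by rewrite -mulmxA mul_mx_row Nv mul_mx_row mulmx0 uNW row_mx0.
apply: contra_neq u0 => uN0.
by rewrite -[u]mulmx1 -Nl mulmx_colsub uN0; apply/rowP => i; rewrite !mxE.
Qed.

Lemma left_row_free_le r s (V : 'M[F]_(r, s)) : left_row_free V -> (r <= s)%N.
Proof.
move=> freeV; rewrite leqNgt; apply/negP => lt_sr.
move: V freeV; rewrite -(subnKC lt_sr) => V freeV.
have [u u0 uV] := left_row_dependent (usubmx V).
move/eqP: u0; apply.
have /freeV/eqP : row_mx u 0 *m V = 0 by rewrite -[V]vsubmxK mul_row_col mul0mx addr0.
by rewrite row_mx_eq0 => /andP[/eqP].
Qed.

(** The one-sided inverses [R] and [T] certify that [S] has independent columns and [V] independent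
    rows, so that rank arguments become matrix identities. *)
Definition full_rank_factorization m n r (A : 'M[F]_(m, n)) : Prop :=
  exists (S : 'M_(m, r)) (V : 'M_(r, n)) (R : 'M_(r, m)) (T : 'M_(n, r)),
    [/\ A = S *m V, R *m S = 1%:M & V *m T = 1%:M].

(** Induction on rows: the residue [b] of a new row modulo the rows of [V] is either zero or joins
    [V] as a further independent row. *)
Lemma full_rank_factorization_exists m n (A : 'M[F]_(m, n)) :
  exists r, full_rank_factorization r A.
Proof.
elim: m A => [|m IHm].
  by exists 0%N, 0, 0, 0, 0; split; rewrite [LHS]flatmx0 [RHS]flatmx0.
change (forall A : 'M[F]_(1 + m, n), exists r, full_rank_factorization r A) => A.
rewrite -[A]vsubmxK; set a := usubmx _.
have [r [S [V [R [T [-> RS VT]]]]]] := IHm (dsubmx A).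
have [b defb] : exists b, b = a - a *m T *m V by eexists.
have bT : b *m T = 0 by rewrite defb mulmxBl -!mulmxA VT mulmx1 subrr.
have [j b_j|b0] := pickP (fun j => b 0 j != 0); last first.
  exists r, (col_mx (a *m T) S), V, (row_mx 0 R), T; split=> //.
    rewrite mul_col_mx; congr col_mx; apply/eqP; rewrite -subr_eq0.
    by apply/eqP/rowP => i; rewrite -defb [RHS]mxE; have /negbFE/eqP := b0 i.
  by rewrite mul_row_col mul0mx add0r.
exists (1 + r)%N.
(* The factor [1 - T V] forces [V c = 0], and [b c = 1] survives it because [b T = 0]. *)
pose c := (1%:M - T *m V) *m (delta_mx j 0 *m ((b 0 j)^-1)%:M) : 'cV_n.
exists (block_mx 1%:M (a *m T) 0 S), (col_mx b V), (block_mx 1%:M (- (a *m T *m R)) 0 R),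
  (row_mx c T); split.
- by rewrite mul_block_col mul1mx mul0mx add0r defb subrK.
- rewrite mulmx_block !mul1mx !mul0mx !mulmx0 !add0r RS addr0 mulNmx.
  rewrite -[_ *m R *m S]mulmxA RS mulmx1 subrr.
  by rewrite scalar_mx_block.
- rewrite mul_col_row VT bT scalar_mx_block; congr (block_mx _ _ _ _).
    rewrite mulmxA mulmxBr mulmx1 [b *m (T *m V)]mulmxA bT mul0mx subr0 mulmxA -colE.
    by apply/matrixP => i k; rewrite !ord1 !mxE big_ord1 !mxE mulrV // unit_neq0.
  by rewrite mulmxA mulmxBr mulmx1 [V *m (T *m V)]mulmxA VT mul1mx subrr mul0mx.
Qed.

(** The left inverse of [S] makes [V] a basis of the row space of [A]. Two bases factor through each
    other by matrices with free rows, so their sizes agree and [xget] can only return [r]. *)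
Lemma rk_factorization m n r (A : 'M[F]_(m, n)) :
  full_rank_factorization r A -> rk A = r.
Proof.
move=> [S [V [R [T [defA RS VT]]]]].
have freeV : left_row_free V by move=> u uV; rewrite -[u]mulmx1 -VT mulmxA uV mul0mx.
have basisV : left_row_basis A V.
  split=> //; apply/seteqP; split=> _ [u _ <-].
    by exists (u *m R) => //; rewrite defA -!mulmxA [R *m _]mulmxA RS mul1mx.
  by exists (u *m S) => //; rewrite defA mulmxA.
have le_basis r1 r2 (V1 : 'M_(r1, n)) (V2 : 'M_(r2, n)) :
    left_row_basis A V1 -> left_row_basis A V2 -> (r1 <= r2)%N.
  move=> [free1 span1] [_ span2].
  have V1sub i : exists u, u *m V2 = row i V1.
    have : left_row_space V1 (row i V1) by exists (delta_mx 0 i) => //; rewrite -rowE.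
    by rewrite span1 -span2 => -[u]; exists u.
  have [Y YV] : exists Y, Y *m V2 = V1.
    exists (\matrix_i projT1 (cid (V1sub i))); apply/row_matrixP => i.
    by rewrite row_mul rowK; case: cid.
  by apply: (@left_row_free_le _ _ Y) => u uY; apply: free1; rewrite -YV mulmxA uY mul0mx.
have [] := @xgetPex _ 0%N [set r | exists V : 'M_(r, n), left_row_basis A V]%classic.
  by exists r, V.
move=> V' basisV'; apply/eqP; rewrite eqn_leq /rk.
by rewrite (le_basis _ _ _ _ basisV' basisV) (le_basis _ _ _ _ basisV basisV').
Qed.

Lemma rk_factor m n (A : 'M[F]_(m, n)) : exists2 r, rk A = r & full_rank_factorization r A.
Proof.
have [r Ar] := full_rank_factorization_exists A.
by exists r; first exact: rk_factorization.
Qed.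

(** After factoring both matrices, [R' X S] has a right inverse, hence free rows, and its two
    dimensions are the two ranks. *)
Lemma rk_mulmx_le m n p q (X : 'M[F]_(m, n)) (A : 'M_(n, p)) (Y : 'M_(p, q)) :
  (rk (X *m A *m Y) <= rk A)%N.
Proof.
have [r' -> [S' [V' [R' [T' [defXAY RS' VT']]]]]] := rk_factor (X *m A *m Y).
have [r -> [S [V [_ [_ [defA _ _]]]]]] := rk_factor A.
have RXSV : R' *m X *m S *m (V *m Y *m T') = 1%:M.
  rewrite !mulmxA -(mulmxA _ S V) -defA -(mulmxA R' X A) -(mulmxA R' _ Y) defXAY.
  by rewrite mulmxA RS' mul1mx.
apply: (@left_row_free_le _ _ (R' *m X *m S)) => u uR.
by rewrite -[u]mulmx1 -RXSV (mulmxA u) uR mul0mx.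
Qed.

Lemma rk_mulmx m n p q (A : 'M[F]_(m, n)) (B : 'M_(p, q)) X Y X' Y' :
  B = X *m A *m Y -> A = X' *m B *m Y' -> rk A = rk B.
Proof.
move=> defB defA; apply/eqP; rewrite eqn_leq.
by rewrite {1}defA rk_mulmx_le {1}defB rk_mulmx_le.
Qed.

Lemma rk_castmx m n m' n' (e : (m = m') * (n = n')) (A : 'M[F]_(m, n)) :
  rk (castmx e A) = rk A.
Proof. by case: e => e1 e2; case: m' / e1; case: n' / e2; rewrite castmx_id. Qed.

Lemma rk_eq0 m n (A : 'M[F]_(m, n)) : rk A = 0%N <-> A = 0.
Proof.
split=> [A0|->].
  have [r rkA [S [V [_ [_ [-> _ _]]]]]] := rk_factor A.
  by move: S V; rewrite -rkA A0 => S V; rewrite [V]flatmx0 mulmx0.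
apply: rk_factorization; exists 0, 0, 0, 0.
by split; rewrite ?mulmx0 // [RHS]flatmx0.
Qed.

(** The witness [T R] makes [A G] and [G A] projections onto the column and row spaces; kernels then
    come as [1 - A G] and [1 - G A]. *)
Lemma reflexive_ginverse m n (A : 'M[F]_(m, n)) :
  exists G : 'M_(n, m), A *m G *m A = A /\ G *m A *m G = G.
Proof.
have [r _ [S [V [R [T [-> RS VT]]]]]] := rk_factor A.
exists (T *m R); split; rewrite !mulmxA.
  by rewrite -[S *m V *m T]mulmxA VT mulmx1 -[S *m R *m S]mulmxA RS mulmx1.
by rewrite -[T *m R *m S]mulmxA RS mulmx1 -[T *m V *m T]mulmxA VT mulmx1.
Qed.

Lemma left_kernel m n (A : 'M[F]_(m, n)) :
  exists K : 'M_m, K *m A = 0 /\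
    forall k (x : 'M_(k, m)), x *m A = 0 -> x = x *m K.
Proof.
have [G [AGA _]] := reflexive_ginverse A.
exists (1%:M - A *m G); split=> [|k x xA]; first by rewrite mulmxBl mul1mx AGA subrr.
by rewrite mulmxBr mulmx1 mulmxA xA mul0mx subr0.
Qed.

Lemma right_kernel m n (A : 'M[F]_(m, n)) :
  exists K : 'M_n, A *m K = 0 /\
    forall k (y : 'M_(n, k)), A *m y = 0 -> y = K *m y.
Proof.
have [G [AGA _]] := reflexive_ginverse A.
exists (1%:M - G *m A); split=> [|k y Ay]; first by rewrite mulmxBr mulmx1 mulmxA AGA subrr.
by rewrite mulmxBl mul1mx -mulmxA Ay mulmx0 subr0.
Qed.

(** Block elimination: [L = 1 - S R] has the same row space as [K], and factorizations of [P] and of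
    [L M] assemble into one of the joint matrix. *)
Lemma rk_row_mx m n p (M : 'M[F]_(m, n)) (P : 'M_(m, p)) (K : 'M_m) :
  K *m P = 0 -> (forall k (x : 'M_(k, m)), x *m P = 0 -> x = x *m K) ->
  rk (row_mx M P) = (rk P + rk (K *m M))%N.
Proof.
move=> KP Kmax; have [r -> [S [V [R [T [defP RS VT]]]]]] := rk_factor P.
pose L := 1%:M - S *m R.
have LS : L *m S = 0 by rewrite mulmxBl mul1mx -mulmxA RS mulmx1 subrr.
have RL : R *m L = 0 by rewrite mulmxBr mulmx1 mulmxA RS mul1mx subrr.
have KS : K *m S = 0.
  by rewrite -[K *m S]mulmx1 -VT -mulmxA [S *m _]mulmxA -defP mulmxA KP mul0mx.
have KL : K *m L = K by rewrite mulmxBr mulmx1 mulmxA KS mul0mx subr0.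
have LK : L *m K = L by rewrite -Kmax // defP mulmxA LS mul0mx.
have -> : rk (K *m M) = rk (L *m M).
  by apply: (@rk_mulmx _ _ _ _ _ _ L 1%:M K 1%:M); rewrite mulmx1 mulmxA ?LK ?KL.
have [r' -> [S' [V' [R' [T' [defM RS' VT']]]]]] := rk_factor (L *m M).
have defS' : S' = L *m (M *m T') by rewrite mulmxA defM -mulmxA VT' mulmx1.
have RS'0 : R *m S' = 0 by rewrite defS' mulmxA RL mul0mx.
have LS' : L *m S' = S' by rewrite {1}/L mulmxBl mul1mx -mulmxA RS'0 mulmx0 subr0.
apply: rk_factorization.
exists (row_mx S S'), (block_mx (R *m M) V V' 0), (col_mx R (R' *m L)),
  (block_mx 0 T' T (- (T *m R *m M *m T'))); split.
- rewrite mul_row_block mulmx0 addr0 -defP -defM; congr row_mx.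
  by rewrite mulmxA -mulmxDl addrC subrK mul1mx.
- by rewrite mul_col_row RS RS'0 -!mulmxA LS LS' RS' mulmx0 scalar_mx_block.
- rewrite mulmx_block !mulmx0 !mul0mx VT VT' mulmxN -!mulmxA [V *m _]mulmxA VT mul1mx subrr.
  by rewrite add0r !addr0 scalar_mx_block.
Qed.

Lemma rk_row_mxC m n p (M : 'M[F]_(m, n)) (P : 'M_(m, p)) :
  rk (row_mx M P) = rk (row_mx P M).
Proof.
by apply: (@rk_mulmx _ _ _ _ _ _ 1%:M (block_mx 0 1%:M 1%:M 0) 1%:M (block_mx 0 1%:M 1%:M 0));
  rewrite mul1mx mul_row_block !mulmx0 !mulmx1 !(add0r, addr0).
Qed.

Lemma rk_row_mx_eql m n p (P : 'M[F]_(m, p)) (M : 'M_(m, n)) :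
  rk (row_mx P M) = rk P <->
  forall k (x : 'M_(k, m)), x *m P = 0 -> x *m M = 0.
Proof.
have [K [KP Kmax]] := left_kernel P.
rewrite rk_row_mxC (rk_row_mx _ KP Kmax); split=> [rkM k x xP|MP].
  have /rk_eq0 KM : rk (K *m M) = 0%N by apply/eqP; rewrite -(eqn_add2l (rk P)) rkM addn0.
  by rewrite (Kmax _ _ xP) -mulmxA KM mulmx0.
by rewrite (MP _ _ KP) (rk_eq0 0).2 ?addn0.
Qed.

(** Mirror image of [rk_row_mx], proved separately because plain transposition need not preserve
    rank over a noncommutative division ring. *)
Lemma rk_col_mx m n p (M : 'M[F]_(m, n)) (Q : 'M_(p, n)) (K : 'M_n) :
  Q *m K = 0 -> (forall k (y : 'M_(n, k)), Q *m y = 0 -> y = K *m y) ->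
  rk (col_mx M Q) = (rk Q + rk (M *m K))%N.
Proof.
move=> QK Kmax; have [r -> [S [V [R [T [defQ RS VT]]]]]] := rk_factor Q.
pose L := 1%:M - T *m V.
have VL : V *m L = 0 by rewrite mulmxBr mulmx1 mulmxA VT mul1mx subrr.
have LT : L *m T = 0 by rewrite mulmxBl mul1mx -mulmxA VT mulmx1 subrr.
have VK : V *m K = 0.
  by rewrite -[V *m K]mul1mx -RS -mulmxA [S *m _]mulmxA -defQ QK mulmx0.
have LK : L *m K = K by rewrite mulmxBl mul1mx -mulmxA VK mulmx0 subr0.
have KL : K *m L = L by rewrite -Kmax // defQ -mulmxA VL mulmx0.
have -> : rk (M *m K) = rk (M *m L).
  by apply: (@rk_mulmx _ _ _ _ _ _ 1%:M L 1%:M K); rewrite mul1mx -mulmxA ?LK ?KL.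
have [r' -> [S' [V' [R' [T' [defM RS' VT']]]]]] := rk_factor (M *m L).
have defV' : V' = R' *m M *m L by rewrite -mulmxA defM mulmxA RS' mul1mx.
have V'T : V' *m T = 0 by rewrite defV' -mulmxA LT mulmx0.
have V'L : V' *m L = V' by rewrite {1}/L mulmxBr mulmx1 mulmxA V'T mul0mx subr0.
apply: rk_factorization.
exists (block_mx (M *m T) S' S 0), (col_mx V V'),
  (block_mx 0 R R' (- (R' *m M *m T *m R))), (row_mx T (L *m T')); split.
- rewrite mul_block_col mul0mx addr0 -defQ -defM; congr col_mx.
  by rewrite -mulmxA -mulmxDr addrC subrK mulmx1.
- rewrite mulmx_block !mulmx0 !mul0mx RS RS' mulNmx -!mulmxA RS mulmx1 subrr.
  by rewrite add0r !addr0 scalar_mx_block.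
- by rewrite mul_col_row VT V'T !mulmxA VL V'L VT' mul0mx scalar_mx_block.
Qed.

Lemma rk_col_mx0 m n p (P : 'M[F]_(m, n)) : rk (col_mx P (0 : 'M_(p, n))) = rk P.
Proof.
apply: (@rk_mulmx _ _ _ _ _ _ (row_mx 1%:M 0) 1%:M (col_mx 1%:M 0) 1%:M).
  by rewrite mulmx1 mul_row_col mul1mx mulmx0 addr0.
by rewrite mulmx1 mul_col_mx mul1mx mul0mx.
Qed.

Lemma rk_block_mx_eq m n p q (M : 'M[F]_(m, n)) (P : 'M_(m, p)) (Q : 'M_(q, n)) :
  rk (block_mx M P Q 0) = (rk P + rk Q)%N <->
  forall k l (x : 'M_(k, m)) (y : 'M_(n, l)),
    x *m P = 0 -> Q *m y = 0 -> x *m M *m y = 0.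
Proof.
have [K [KP Kmax]] := left_kernel P; have [K' [QK Kmax']] := right_kernel Q.
rewrite block_mxEh (@rk_row_mx _ _ _ _ _ (block_mx K 0 0 1%:M)); first last.
- move=> k x; rewrite -[x]hsubmxK mul_row_col mulmx0 addr0 => xP.
  by rewrite mul_row_block !mulmx0 addr0 add0r mulmx1 -Kmax.
- by rewrite mul_block_col KP !mul0mx mulmx0 !addr0 col_mx0.
rewrite mul_block_col !mul0mx addr0 add0r mul1mx (rk_col_mx _ QK Kmax') rk_col_mx0.
split=> [rkM k l x y xP Qy|MPQ].
  have /rk_eq0 KMK : rk (K *m M *m K') = 0%N.
    by apply/eqP; rewrite -(eqn_add2l (rk P + rk Q)) -addnA rkM addn0.
  by rewrite (Kmax _ _ xP) (Kmax' _ _ Qy) mulmxA -2!(mulmxA x) KMK mulmx0 mul0mx.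
by rewrite (MPQ _ _ _ _ KP QK) (rk_eq0 0).2 ?addn0.
Qed.

Lemma rk_row_mxA m n p q (A : 'M[F]_(m, n)) (B : 'M_(m, p)) (C : 'M_(m, q)) :
  rk (row_mx A (row_mx B C)) = rk (row_mx (row_mx A B) C).
Proof. by rewrite row_mxA rk_castmx. Qed.

Lemma rk_col_mxA m n p q (A : 'M[F]_(m, q)) (B : 'M_(n, q)) (C : 'M_(p, q)) :
  rk (col_mx A (col_mx B C)) = rk (col_mx (col_mx A B) C).
Proof. by rewrite col_mxA rk_castmx. Qed.

(** Regroups nested rows of blocks into the bordered shape of [rk_block_mx_eq]; the casts of
    reassociation leave [rk] unchanged. *)
Lemma rk_block_mxA m1 m2 m3 n1 n2 n3
    (A11 : 'M[F]_(m1, n1)) (A12 : 'M_(m1, n2)) (A13 : 'M_(m1, n3))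
    (A21 : 'M_(m2, n1)) (A22 : 'M_(m2, n2)) (A23 : 'M_(m2, n3))
    (A31 : 'M_(m3, n1)) (A32 : 'M_(m3, n2)) (A33 : 'M_(m3, n3)) :
  rk (col_mx (row_mx A11 (row_mx A12 A13))
     (col_mx (row_mx A21 (row_mx A22 A23)) (row_mx A31 (row_mx A32 A33)))) =
  rk (block_mx (block_mx A11 A12 A21 A22) (col_mx A13 A23) (row_mx A31 A32) A33).
Proof.
rewrite rk_col_mxA !col_mx_row_mx rk_row_mxA -[row_mx (col_mx _ _) (col_mx _ A32)]col_mx_row_mx.
rewrite -[row_mx (col_mx (row_mx _ _) _) _]col_mx_row_mx /block_mx.
by rewrite [col_mx (row_mx A11 _) _]col_mx_row_mx.
Qed.

Lemma rk_bordered_diag3 m1 m2 m3 m4 n1 n2 n3 n4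
    (a : 'M[F]_(m1, n1)) (b : 'M_(m2, n2)) (c : 'M_(m3, n3))
    (P1 : 'M_(m1, n4)) (P2 : 'M_(m2, n4)) (P3 : 'M_(m3, n4))
    (Q1 : 'M_(m4, n1)) (Q2 : 'M_(m4, n2)) (Q3 : 'M_(m4, n3)) :
  rk (col_mx (row_mx a  (row_mx 0  (row_mx 0  P1)))
     (col_mx (row_mx 0  (row_mx b  (row_mx 0  P2)))
     (col_mx (row_mx 0  (row_mx 0  (row_mx c  P3)))
             (row_mx Q1 (row_mx Q2 (row_mx Q3 0)))))) =
  rk (block_mx (block_mx (block_mx a 0 0 b) 0 0 c)
               (col_mx (col_mx P1 P2) P3) (row_mx (row_mx Q1 Q2) Q3) 0).
Proof.
rewrite [col_mx (row_mx 0 (row_mx 0 (row_mx c _))) _]col_mx_row_mx.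
rewrite [col_mx (row_mx 0 (row_mx c _)) _]col_mx_row_mx rk_block_mxA.
rewrite (col_mx_row_mx 0 P1) col_mx0 -(col_mx_row_mx 0 0 Q1 Q2) row_mx0.
by rewrite {1}/block_mx -(col_mx_row_mx 0 _ (row_mx Q1 Q2)) rk_block_mxA.
Qed.

End DivisionRingRank.

(* With c = (1 - beta) a for a projection beta onto the image of b, and h a reflexive inverse
   of c killing beta, the columns of a (1 - h a) span the intersection of the two images;
   beta is corrected to kill a h, and a h is completed by a projection onto the intersection.
   The auxiliary matrices are opaque because [!mulmxA] would unfold local definitions. *)
Lemma commuting_projections (F : unitRingType) (divF : division_ring F) m n p
    (a : 'M[F]_(m, n)) (b : 'M[F]_(m, p)) :
  exists (a' : 'M_(n, m)) (b' : 'M_(p, m)),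
    [/\ a *m a' *m a = a, b *m b' *m b = b
      & a *m a' *m (b *m b') = b *m b' *m (a *m a')].
Proof.
have [b0 [bb0b _]] := reflexive_ginverse divF b.
pose beta := b *m b0; pose cbeta := 1%:M - beta.
have bbK : beta *m beta = beta by rewrite /beta mulmxA bb0b.
have cbb : cbeta *m beta = 0 by rewrite mulmxBl mul1mx bbK subrr.
have cbK : cbeta *m cbeta = cbeta by rewrite {2}/cbeta mulmxBr mulmx1 cbb subr0.
have [g [gc gcg]] := reflexive_ginverse divF (cbeta *m a); rewrite !mulmxA in gc gcg.
have [h defh] : exists h, h = g *m cbeta by eexists.
have [kappa defkappa] : exists kappa, kappa = 1%:M - h *m a by eexists.
have hb : h *m beta = 0 by rewrite defh -mulmxA cbb mulmx0.
have hah : h *m a *m h = h by rewrite defh !mulmxA gcg.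
have be : beta *m (a *m kappa) = a *m kappa.
  have : cbeta *m (a *m kappa) = 0.
    by rewrite defkappa defh mulmxA mulmxBr mulmx1 !mulmxA gc subrr.
  by rewrite mulmxBl mul1mx => /eqP; rewrite subr_eq0 => /eqP.
have [f [efe _]] := reflexive_ginverse divF (a *m kappa).
have [gamma defgamma] : exists gamma, gamma = a *m kappa *m f by eexists.
have [beta' defbeta'] : exists beta', beta' = beta *m (1%:M - a *m h) by eexists.
have ahah : a *m h *m (1%:M - a *m h) = 0.
  by rewrite mulmxBr mulmx1 !mulmxA -(mulmxA a h a) -(mulmxA a) hah subrr.
have bg : beta *m gamma = gamma by rewrite defgamma mulmxA be.
have hg : h *m gamma = 0 by rewrite -bg mulmxA hb mul0mx.
have b'g : beta' *m gamma = gamma.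
  by rewrite defbeta' -mulmxA mulmxBl mul1mx -(mulmxA a) hg mulmx0 subr0.
have b'b : beta' *m beta = beta.
  by rewrite defbeta' -mulmxA mulmxBl mul1mx -(mulmxA a) hb mulmx0 subr0 bbK.
have hb' : h *m beta' = 0 by rewrite defbeta' mulmxA hb mul0mx.
have b'ah : beta' *m (a *m h) = 0.
  rewrite defbeta' -mulmxA mulmxBl mul1mx !mulmxA -(mulmxA a h a) -(mulmxA a) hah.
  by rewrite subrr mulmx0.
have b'a : beta' *m a = a *m kappa.
  by rewrite defbeta' -be -mulmxA defkappa mulmxBl [a *m (_ - _)]mulmxBr mul1mx mulmx1 mulmxA.
have b'b' : beta' *m beta' = beta' by rewrite {2}defbeta' mulmxA b'b.
exists (h + kappa *m f *m beta'), (b0 *m (1%:M - a *m h)).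
have -> : b *m (b0 *m (1%:M - a *m h)) = beta' by rewrite defbeta' mulmxA.
have -> : a *m (h + kappa *m f *m beta') = a *m h + gamma *m beta'.
  by rewrite mulmxDr !mulmxA defgamma.
split.
- rewrite mulmxDl -(mulmxA gamma) b'a defgamma efe -mulmxA -mulmxDr.
  by rewrite defkappa addrC subrK mulmx1.
- by rewrite -[X in _ *m X = _]bb0b mulmxA b'b bb0b.
- by rewrite mulmxDl mulmxDr b'ah -(mulmxA a) hb' mulmx0 !add0r mulmxA b'g -mulmxA b'b'.
Qed.

Section ZmodIdentities.

Variables (V : zmodType) (x y z u v : V).

(** Products with two complementary projections expand to the left-hand shape; the right-hand one
    isolates [x]. *)
Lemma subrB_swap : x - y - (z - u) = x - (z + y - u).
Proof. by rewrite -addrA -opprD addrCA addrA. Qed.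

Lemma addr_cancel3 : x + y - z + (v - y) + (u - x) = u + v - z.
Proof.
rewrite addrC -[x + y - z]addrA -(addrA x) addrA subrK [v - y]addrC addrACA subrr.
by rewrite add0r [- z + v]addrC addrA.
Qed.

End ZmodIdentities.

(** * Conjugate transposition *)

Section Hermitian.

Variables (F : unitRingType) (star : F -> F).
Hypotheses (divF : division_ring F) (starP : involutive_antiautomorphism star).
Hypothesis char_neq2 : 2%N \notin [pchar F].

Local Notation "A ^H" := (conjtr star A) (at level 8, format "A ^H").

Let starD x y : star (x + y) = star x + star y. Proof. by case: starP. Qed.
Let starM x y : star (x * y) = star y * star x. Proof. by case: starP. Qed.
Let starK : involutive star. Proof. by case: starP. Qed.
Let star1 : star 1 = 1. Proof. by case: starP. Qed.
Let star0 : star 0 = 0. Proof. by apply: (addrI (star 0)); rewrite -starD !addr0. Qed.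
Let starN x : star (- x) = - star x.
Proof. by apply: (addrI (star x)); rewrite -starD !subrr. Qed.

Lemma conjtrK m n (A : 'M[F]_(m, n)) : A^H^H = A.
Proof. by apply/matrixP => i j; rewrite !mxE starK. Qed.

Lemma conjtrD m n (A B : 'M[F]_(m, n)) : (A + B)^H = A^H + B^H.
Proof. by apply/matrixP => i j; rewrite !mxE starD. Qed.

Lemma conjtrN m n (A : 'M[F]_(m, n)) : (- A)^H = - A^H.
Proof. by apply/matrixP => i j; rewrite !mxE starN. Qed.

Lemma conjtrB m n (A B : 'M[F]_(m, n)) : (A - B)^H = A^H - B^H.
Proof. by rewrite conjtrD conjtrN. Qed.

Lemma conjtr0 m n : (0 : 'M[F]_(m, n))^H = 0.
Proof. by apply/matrixP => i j; rewrite !mxE star0. Qed.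

Lemma conjtr1 n : (1%:M : 'M[F]_n)^H = 1%:M.
Proof. by apply/matrixP => i j; rewrite !mxE eq_sym; case: eqP; rewrite ?star1 ?star0. Qed.

Lemma conjtrM m n p (A : 'M[F]_(m, n)) (B : 'M_(n, p)) : (A *m B)^H = B^H *m A^H.
Proof.
apply/matrixP => i j; rewrite !mxE (big_morph star starD star0).
by apply: eq_bigr => k _; rewrite starM !mxE.
Qed.

Lemma conjtr_row_mx m n p (A : 'M[F]_(m, n)) (B : 'M_(m, p)) :
  (row_mx A B)^H = col_mx A^H B^H.
Proof. by rewrite /conjtr tr_row_mx map_col_mx. Qed.

Lemma conjtr_col_mx m n p (A : 'M[F]_(m, n)) (B : 'M_(p, n)) :
  (col_mx A B)^H = row_mx A^H B^H.
Proof. by rewrite /conjtr tr_col_mx map_row_mx. Qed.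

Lemma rk_conjtr m n (A : 'M[F]_(m, n)) : rk A^H = rk A.
Proof.
have [r -> [S [V [R [T [-> RS VT]]]]]] := rk_factor divF A.
apply: (rk_factorization divF); exists V^H, S^H, T^H, R^H.
by rewrite -!conjtrM RS VT conjtr1.
Qed.

(** * Hermitian matrix equations solved by projections *)

Lemma commuting_row_projections m n p (a : 'M[F]_(m, n)) (b : 'M[F]_(p, n)) :
  exists (a' : 'M_(n, m)) (b' : 'M_(n, p)),
    [/\ a *m a' *m a = a, b *m b' *m b = b
      & a' *m a *m (b' *m b) = b' *m b *m (a' *m a)].
Proof.
have [a' [b' [aa'a bb'b comm]]] := commuting_projections divF a^H b^H.
exists a'^H, b'^H; split.
- by rewrite -[RHS]conjtrK -aa'a !conjtrM !conjtrK mulmxA.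
- by rewrite -[RHS]conjtrK -bb'b !conjtrM !conjtrK mulmxA.
- by have := congr1 (@conjtr F star n n) comm; rewrite !conjtrM !conjtrK => <-.
Qed.

(** The witness is half of [G]: the inverse of two is central and fixed by [star], so scaling by it
    commutes with conjugate transposition. *)
Lemma hermitian_split n (G : 'M[F]_n) : G = G^H -> exists G' : 'M_n, G' + G'^H = G.
Proof.
move=> hermG; have two_neq0 : (2%:R : F) != 0.
  by move: char_neq2; rewrite inE.
have two_unit : (2%:R : F) \is a GRing.unit by exact: divF.
pose h : F := 2%:R^-1.
have hh : h + h = 1 by rewrite -mulr2n -mulr_natr mulVr.
have comm_h x : x * h = h * x by apply: commrV; exact: commr_nat.
have star_h : star h = h.
  by rewrite -[LHS]mulr1 -hh mulrDr -mulrDl -starD hh star1 mul1r.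
exists (h *: G); apply/matrixP => i j.
have Gij : star (G j i) = G i j by rewrite {2}hermG !mxE.
by rewrite !mxE starM star_h Gij comm_h -mulrDl hh mul1r.
Qed.

(* The solution glues the two forms along commuting projections onto the row spaces. *)
Lemma two_congruence_equations p s t (C : 'M[F]_(s, p)) (D : 'M_(t, p))
    (Psi : 'M_s) (Omega : 'M_t) :
  Psi = Psi^H -> Omega = Omega^H ->
  (forall k (y : 'M_(k, s)), y *m C = 0 -> y *m Psi = 0) ->
  (forall k (z : 'M_(k, t)), z *m D = 0 -> z *m Omega = 0) ->
  (forall k (y : 'M_(k, s)) (z : 'M_(k, t)), y *m C = z *m D ->
     y *m Psi *m y^H = z *m Omega *m z^H) ->
  exists X : 'M_p, [/\ X = X^H, C *m X *m C^H = Psi & D *m X *m D^H = Omega].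
Proof.
move=> hPsi hOmega kerC kerD agree.
have [C' [D' [CC'C DD'D comm]]] := commuting_row_projections C D.
have CPsi : C *m C' *m Psi = Psi.
  apply/eqP; rewrite -subr_eq0 -{2}[Psi]mul1mx -mulmxBl; apply/eqP/kerC.
  by rewrite mulmxBl mul1mx CC'C subrr.
have DOmega : D *m D' *m Omega = Omega.
  apply/eqP; rewrite -subr_eq0 -{2}[Omega]mul1mx -mulmxBl; apply/eqP/kerD.
  by rewrite mulmxBl mul1mx DD'D subrr.
pose form n (U : 'M_(p, n)) (P : 'M_n) := U *m P *m U^H.
have formM k n (W : 'M_(k, p)) (U : 'M_(p, n)) P :
    W *m form n U P *m W^H = W *m U *m P *m (W *m U)^H.
  by rewrite /form conjtrM !mulmxA.
have formH n (U : 'M_(p, n)) P : P = P^H -> form n U P = (form n U P)^H.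
  by move=> hP; rewrite /form !conjtrM conjtrK -hP mulmxA.
(* Inclusion-exclusion: the two pulled-back forms minus the form on the overlap. Tested on [C], the
   last two terms cancel by [agree]; tested on [D], the first and last cancel because
   [D D' D = D]. *)
exists (form _ C' Psi + form _ D' Omega - form _ (D' *m D *m C') Psi); split.
- by rewrite conjtrB conjtrD -!formH.
- rewrite mulmxBr mulmxDr mulmxBl mulmxDl !formM.
  have -> : C *m D' *m Omega *m (C *m D')^H
      = C *m (D' *m D *m C') *m Psi *m (C *m (D' *m D *m C'))^H.
    apply/esym/agree; rewrite -(mulmxA C) -(mulmxA _ C') -comm !mulmxA CC'C //.
  rewrite addrK CPsi.
  by rewrite {1}hPsi -conjtrM CPsi -hPsi.
- rewrite mulmxBr mulmxDr mulmxBl mulmxDl !formM !mulmxA DD'D.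
  by rewrite addrAC subrr add0r DOmega {1}hOmega -conjtrM DOmega -hOmega.
Qed.

(* With commuting projections alpha, beta onto the column spaces of a, b, the hypotheses give
   G = alpha G beta^* + beta G alpha^* - (alpha beta) G (alpha beta)^*, whose last term is
   split in two halves. *)
Lemma ABstar_plus_BAstar k p q (a : 'M[F]_(k, p)) (b : 'M_(k, q)) (G : 'M_k) :
  G = G^H ->
  (forall l (x : 'M_(l, k)), x *m a = 0 -> x *m b = 0 -> x *m G = 0) ->
  (forall l (x : 'M_(l, k)), x *m a = 0 -> x *m G *m x^H = 0) ->
  (forall l (x : 'M_(l, k)), x *m b = 0 -> x *m G *m x^H = 0) ->
  exists Z : 'M_(p, q), a *m Z *m b^H + (a *m Z *m b^H)^H = G.
Proof.
move=> hG kerab kera kerb.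
have [a' [b' [aa'a bb'b comm]]] := commuting_projections divF a b.
have [G' defG] := hermitian_split hG.
exists (a' *m (G - b *m b' *m G' *m (a *m a')^H) *m b'^H).
have -> : a *m (a' *m (G - b *m b' *m G' *m (a *m a')^H) *m b'^H) *m b^H =
    a *m a' *m (G - b *m b' *m G' *m (a *m a')^H) *m (b *m b')^H.
  by rewrite [X in _ = _ *m X]conjtrM !mulmxA.
have alpha_a : (1%:M - a *m a') *m a = 0 by rewrite mulmxBl mul1mx aa'a subrr.
have beta_b : (1%:M - b *m b') *m b = 0 by rewrite mulmxBl mul1mx bb'b subrr.
move: {aa'a bb'b} (a *m a') (b *m b') comm alpha_a beta_b => alpha beta comm alpha_a beta_b.
have [Q defQ] : exists Q, Q = beta *m G *m beta^H by eexists.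
(* The three kernel hypotheses are used at [(1 - alpha) (1 - beta)], at [1 - beta], and at
   [1 - alpha] compressed by [beta]; they yield [G_ab], [GQ] and [QQ]. *)
have G_ab : G = beta *m G + alpha *m G - alpha *m beta *m G.
  apply/eqP; rewrite -subr_eq0 -subrB_swap; apply/eqP.
  rewrite -[RHS](kerab _ ((1%:M - alpha) *m (1%:M - beta))); first last.
  - by rewrite -mulmxA beta_b mulmx0.
  - suff -> : (1%:M - alpha) *m (1%:M - beta) = (1%:M - beta) *m (1%:M - alpha).
      by rewrite -mulmxA alpha_a mulmx0.
    by rewrite !mulmxBr !mulmxBl !mul1mx !mulmx1 comm !subrB_swap [beta + _]addrC.
  by rewrite mulmxBr mulmx1 !mulmxBl !mul1mx.
have Gbeta : G *m beta^H = Q + (alpha *m G *m beta^H - alpha *m Q).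
  by rewrite {1}G_ab mulmxBl mulmxDl defQ !mulmxA addrA.
have betaG : beta *m G = Q + (beta *m G *m alpha^H - Q *m alpha^H).
  have := congr1 (@conjtr F star k k) Gbeta.
  by rewrite defQ !(conjtrD, conjtrN, conjtrM, conjtrK) -!hG !mulmxA.
have GQ : G = beta *m G + G *m beta^H - Q.
  apply/eqP; rewrite -subr_eq0 [_ + G *m _]addrC -subrB_swap; apply/eqP.
  rewrite -[RHS](kerb _ _ beta_b).
  by rewrite conjtrB conjtr1 mulmxBr !mulmxBl !mul1mx !mulmx1 ?defQ.
have QQ : Q = alpha *m Q + Q *m alpha^H - alpha *m Q *m alpha^H.
  apply/eqP; rewrite -subr_eq0 [alpha *m Q + _]addrC -subrB_swap; apply/eqP.
  have : beta *m ((1%:M - alpha) *m G *m (1%:M - alpha)^H) *m beta^H = 0.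
    by rewrite kera // mulmx0 mul0mx.
  have -> : beta *m ((1%:M - alpha) *m G *m (1%:M - alpha)^H) *m beta^H =
    (1%:M - alpha) *m Q *m (1%:M - alpha)^H.
    have cab : beta *m (1%:M - alpha) = (1%:M - alpha) *m beta.
      by rewrite mulmxBr mulmxBl mul1mx mulmx1 comm.
    rewrite defQ !mulmxA cab -!mulmxA; do 3!congr (_ *m _).
    by rewrite -!conjtrM cab.
  by rewrite conjtrB conjtr1 mulmxBr !mulmxBl !mul1mx !mulmx1 ?defQ.
rewrite [RHS]GQ betaG Gbeta [Q + (_ - alpha *m Q)]addrC addrA addrK.
have commH : alpha^H *m beta^H = beta^H *m alpha^H by rewrite -!conjtrM comm.
rewrite {1}QQ mulmxBr mulmxBl conjtrB !conjtrM !conjtrK -hG !mulmxA.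
rewrite addr_cancel3 addrACA -opprD; congr (_ - _).
rewrite -comm -[_ *m alpha^H *m beta^H]mulmxA commH mulmxA -!mulmxDl -mulmxDr defG.
by rewrite defQ !mulmxA.
Qed.

(** With [beta = B B'], the rows of [1 - beta] lie in the kernel spanned by [N], so compressing [S]
    by [1 - beta] gives zero. Hence [S = S beta^H + beta S - beta S beta^H], and halving the last
    term exhibits [B Y] and its conjugate transpose. *)
Lemma B_plus_Bstar m q (B : 'M[F]_(m, q)) (N S : 'M_m) :
  S = S^H -> (forall k (x : 'M_(k, m)), x *m B = 0 -> x = x *m N) ->
  N *m S *m N^H = 0 -> exists Y : 'M_(q, m), B *m Y + (B *m Y)^H = S.
Proof.
move=> hS kerB NSN; have [B' [BB'B _]] := reflexive_ginverse divF B.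
have [S' defS] := hermitian_split hS.
have [K defK] : exists K, K = 1%:M - B *m B' by eexists.
have KN : K = K *m N by apply: kerB; rewrite defK mulmxBl mul1mx BB'B subrr.
have KSK : K *m S *m K^H = 0.
  have -> : K *m S *m K^H = K *m (N *m S *m N^H) *m K^H.
    by rewrite [in LHS]KN conjtrM !mulmxA.
  by rewrite NSN mulmx0 mul0mx.
exists (B' *m (S - S' *m (B *m B')^H)); rewrite mulmxA; move: (B *m B') defK => beta defK.
have -> : beta *m (S - S' *m beta^H) + (beta *m (S - S' *m beta^H))^H =
    S *m beta^H + beta *m S - beta *m S *m beta^H.
  rewrite mulmxBr conjtrB !conjtrM conjtrK -hS addrACA -opprD [beta *m S + _]addrC.
  by rewrite -mulmxA -mulmxDr -mulmxDl defS mulmxA.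
apply/esym/eqP; rewrite -subr_eq0 -subrB_swap -[X in _ == X]KSK defK.
by rewrite conjtrB conjtr1 mulmxBr mulmx1 !mulmxBl !mul1mx.
Qed.

(* A common hermitian form is first sought on the row space of [col_mx C D]: there
   the solutions differ by forms pairing complements of the two row spaces, which
   leaves exactly the freedom to match [Phi] on the part meeting the rows of [A]. *)
Lemma three_congruence_equations p m s t (A : 'M[F]_(m, p)) (C : 'M_(s, p)) (D : 'M_(t, p))
    (Phi : 'M_m) (Psi : 'M_s) (Omega : 'M_t) :
  Phi = Phi^H -> Psi = Psi^H -> Omega = Omega^H ->
  (forall k (x : 'M_(k, m)), x *m A = 0 -> x *m Phi = 0) ->
  (forall k (y : 'M_(k, s)), y *m C = 0 -> y *m Psi = 0) ->
  (forall k (z : 'M_(k, t)), z *m D = 0 -> z *m Omega = 0) ->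
  (forall k (x : 'M_(k, m)) (y : 'M_(k, s)), x *m A = y *m C ->
     x *m Phi *m x^H = y *m Psi *m y^H) ->
  (forall k (x : 'M_(k, m)) (z : 'M_(k, t)), x *m A = z *m D ->
     x *m Phi *m x^H = z *m Omega *m z^H) ->
  (forall k (y : 'M_(k, s)) (z : 'M_(k, t)), y *m C = z *m D ->
     y *m Psi *m y^H = z *m Omega *m z^H) ->
  (forall k l (x : 'M_(k, m)) (y : 'M_(k, s)) (z : 'M_(k, t))
              (x' : 'M_(l, m)) (y' : 'M_(l, s)) (z' : 'M_(l, t)),
     x *m A = y *m C -> x *m A = z *m D -> x' *m A = y' *m C + z' *m D ->
     x *m Phi *m x'^H = y *m Psi *m y'^H + z *m Omega *m z'^H) ->
  exists X : 'M_p, [/\ X = X^H, A *m X *m A^H = Phi, C *m X *m C^H = Psi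
    & D *m X *m D^H = Omega].
Proof.
move=> hPhi hPsi hOmega kerA kerC kerD agreeAC agreeAD agreeCD agreeACD.
have [X0 [hX0 CX0C DX0D]] := two_congruence_equations hPsi hOmega kerC kerD agreeCD.
(* The kernel of the stacked [A], [C], [D] parametrizes the relations [x A = y C + z D]; the rows of
   [lambda A] span the intersection of the row space of [A] with that of [col_mx C D]. *)
have [lambda [nu1 [nu2 [defU maxU]]]] : exists (lambda : 'M_(m + (s + t), m)) nu1 nu2,
    lambda *m A = nu1 *m C + nu2 *m D /\
    forall k (x : 'M_(k, m)) (y : 'M_(k, s)) (z : 'M_(k, t)),
      x *m A = y *m C + z *m D -> exists w, x = w *m lambda.
  have [K [KW Kmax]] := left_kernel divF (col_mx A (col_mx C D)).
  move: KW Kmax; rewrite -[K]hsubmxK -[rsubmx K]hsubmxK.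
  move: (lsubmx K) (lsubmx (rsubmx K)) (rsubmx (rsubmx K)) => lambda mu1 mu2.
  rewrite !mul_row_col => KW Kmax; exists lambda, (- mu1), (- mu2); split.
    by apply/eqP; rewrite -subr_eq0 !mulNmx -opprD opprK KW.
  move=> k x y z xyz; exists (row_mx x (row_mx (- y) (- z))).
  have /Kmax : row_mx x (row_mx (- y) (- z)) *m col_mx A (col_mx C D) = 0.
    by rewrite !mul_row_col !mulNmx -opprD xyz subrr.
  by rewrite mul_mx_row => /eq_row_mx[].
move defU' : (lambda *m A) => U in defU.
have [C' [D' [CC'C DD'D comm]]] := commuting_row_projections C D.
(* Acting on row vectors, [rho] kills the row space of [D] and [sigma] that of [C], so adding
   [rho Z sigma^H] and its conjugate transpose to [X0] preserves both prescribed forms. *)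
have [rho defrho] : exists rho, rho = C' *m C *m (1%:M - D' *m D) by eexists.
have [sigma defsigma] : exists sigma, sigma = D' *m D *m (1%:M - C' *m C) by eexists.
have Cpi : C *m (C' *m C) = C by rewrite mulmxA.
have Dtau : D *m (D' *m D) = D by rewrite mulmxA.
have pipi : C' *m C *m (1%:M - C' *m C) = 0.
  by rewrite mulmxBr mulmx1 -mulmxA Cpi subrr.
have tautau : D' *m D *m (1%:M - D' *m D) = 0.
  by rewrite mulmxBr mulmx1 -mulmxA Dtau subrr.
have Csigma : C *m sigma = 0.
  by rewrite -Cpi -mulmxA defsigma (mulmxA (C' *m C)) comm -(mulmxA (D' *m D)) pipi !mulmx0.
have Drho : D *m rho = 0.
  by rewrite -Dtau -mulmxA defrho (mulmxA (D' *m D)) -comm -(mulmxA (C' *m C)) tautau !mulmx0.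
have rho_pt : rho + C' *m C *m (D' *m D) = C' *m C.
  by rewrite defrho mulmxBr mulmx1 subrK.
have sigma_pt : sigma + C' *m C *m (D' *m D) = D' *m D.
  by rewrite comm defsigma mulmxBr mulmx1 subrK.
(* On the sum of the row spaces of [C] and [D], [rho], [sigma] and the projection onto the
   intersection add up to the identity. *)
have Urst : U = U *m rho + U *m sigma + U *m (C' *m C *m (D' *m D)).
  rewrite -!mulmxDr -addrA sigma_pt defU !mulmxDl !mulmxDr.
  rewrite -!(mulmxA _ D) Drho mulmx0 add0r Dtau; congr (_ + _).
  rewrite -!(mulmxA _ C) -mulmxDr -mulmxDr -sigma_pt addrCA rho_pt mulmxDr.
  by rewrite Csigma add0r Cpi.
pose G := lambda *m Phi *m lambda^H - U *m X0 *m U^H.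
have hG : G = G^H by rewrite /G conjtrB !conjtrM !conjtrK -hPhi -hX0 !mulmxA.
have formUX k (x : 'M_(k, _)) n (y : 'M_(k, n)) E (Th : 'M_n) : x *m U = y *m E ->
    E *m X0 *m E^H = Th -> x *m (U *m X0 *m U^H) *m x^H = y *m Th *m y^H.
  move=> xU <-; have -> : x *m (U *m X0 *m U^H) *m x^H = x *m U *m X0 *m (x *m U)^H.
    by rewrite conjtrM !mulmxA.
  by rewrite xU conjtrM !mulmxA.
have formUA k (x : 'M_(k, _)) :
    x *m (lambda *m Phi *m lambda^H) *m x^H = x *m lambda *m Phi *m (x *m lambda)^H.
  by rewrite conjtrM !mulmxA.
have [Z UZU] : exists Z : 'M_p,
    U *m rho *m Z *m (U *m sigma)^H + (U *m rho *m Z *m (U *m sigma)^H)^H = G.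
  (* [G] is the defect of [X0] against [Phi] on the rows of [U]. A row [x U] killed by both [rho]
     and [sigma] lies in both row spaces, by [rho] in that of [D], by [sigma] in that of [C]; there
     [agreeACD], [agreeAD] and [agreeAC] apply. *)
  apply: ABstar_plus_BAstar => // l x.
  - move=> xrho xsigma.
    have xU : x *m U = x *m U *m (C' *m C *m (D' *m D)).
      by rewrite {1}Urst !mulmxDr xrho xsigma !add0r !mulmxA.
    have xC : x *m lambda *m A = x *m U *m (D' *m D) *m C' *m C.
      by rewrite -mulmxA defU' {1}xU comm !mulmxA.
    have xD : x *m lambda *m A = x *m U *m (C' *m C) *m D' *m D.
      by rewrite -mulmxA defU' {1}xU !mulmxA.
    move: (x *m U *m _ *m C') (x *m U *m _ *m D') xC xD => y z xC xD.
    rewrite /G mulmxBr !mulmxA (agreeACD _ _ _ _ _ _ _ _ xC xD (etrans defU' defU)).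
    rewrite -mulmxA defU' in xC; rewrite -mulmxA defU' in xD.
    rewrite [X in _ *m X0 *m X^H]defU conjtrD !conjtrM mulmxDr !mulmxA {1}xC xD -CX0C -DX0D.
    by rewrite !mulmxA subrr.
  - move=> xrho; have xU : x *m U = x *m U *m D' *m D.
      by rewrite -2!mulmxA -sigma_pt {1}Urst !mulmxDr xrho add0r !mulmxA.
    rewrite /G mulmxBr mulmxBl formUA (formUX _ _ _ _ _ _ xU DX0D).
    by rewrite (agreeAD _ _ (x *m U *m D')) ?subrr // -mulmxA defU'.
  - move=> xsigma; have xU : x *m U = x *m U *m C' *m C.
      by rewrite -2!mulmxA -rho_pt {1}Urst !mulmxDr xsigma addr0 !mulmxA.
    rewrite /G mulmxBr mulmxBl formUA (formUX _ _ _ _ _ _ xU CX0C).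
    by rewrite (agreeAC _ _ (x *m U *m C')) ?subrr // -mulmxA defU'.
pose X1 := X0 + (rho *m Z *m sigma^H + (rho *m Z *m sigma^H)^H).
have hX1 : X1 = X1^H.
  by rewrite /X1 conjtrD -hX0 conjtrD conjtrK [_^H + _]addrC.
have X1E n (E : 'M_(n, p)) : E *m X1 *m E^H = E *m X0 *m E^H +
    (E *m rho *m Z *m (E *m sigma)^H + (E *m rho *m Z *m (E *m sigma)^H)^H).
  by rewrite /X1 !mulmxDr !mulmxDl !conjtrM !conjtrK !mulmxA.
have CX1C : C *m X1 *m C^H = Psi by rewrite X1E Csigma conjtr0 mulmx0 conjtr0 !addr0.
have DX1D : D *m X1 *m D^H = Omega.
  by rewrite X1E Drho !mul0mx conjtr0 !addr0.
have UX1U : U *m X1 *m U^H = lambda *m Phi *m lambda^H.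
  by rewrite X1E UZU /G addrC subrK.
pose W := col_mx C D.
(* The corrected form on the rows of [W] and the form [Phi] on the rows of [A] now agree on the
   intersection, spanned by [U], so they glue. *)
have [X [hX AXA WXW]] : exists X : 'M_p,
    [/\ X = X^H, A *m X *m A^H = Phi & W *m X *m W^H = W *m X1 *m W^H].
  apply: two_congruence_equations => //.
  - by rewrite !conjtrM conjtrK -hX1 mulmxA.
  - by move=> k z zW; rewrite !mulmxA zW !mul0mx.
  move=> k x w xA.
  have [v defx] : exists v, x = v *m lambda.
    by apply: (maxU _ _ (lsubmx w) (rsubmx w)); rewrite -mul_row_col hsubmxK.
  have -> : w *m (W *m X1 *m W^H) *m w^H = w *m W *m X1 *m (w *m W)^H.
    by rewrite conjtrM !mulmxA.
  by rewrite -xA defx -formUA -UX1U -(mulmxA v lambda) defU' [(v *m U)^H]conjtrM !mulmxA.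
have WX n (E : 'M_(n, s + t)) :
    E *m W *m X *m (E *m W)^H = E *m W *m X1 *m (E *m W)^H.
  by rewrite conjtrM !mulmxA -!(mulmxA E) WXW.
exists X; split=> //.
- by have := WX _ (row_mx 1%:M 0); rewrite mul_row_col mul1mx mul0mx addr0 CX1C.
- by have := WX _ (row_mx 0 1%:M); rewrite mul_row_col mul1mx mul0mx add0r DX1D.
Qed.

(** * Rank equalities as conditions on kernel vectors *)

Lemma rk_bordered m n p q (M : 'M[F]_(m, n)) (P : 'M_(m, p)) (Q : 'M_(n, q)) :
  rk (block_mx M P Q^H 0) = (rk P + rk Q)%N <->
  forall k l (x : 'M_(k, m)) (v : 'M_(l, n)), x *m P = 0 -> v *m Q = 0 -> x *m M *m v^H = 0.
Proof.
rewrite -(rk_conjtr Q) rk_block_mx_eq //; split=> [H k l x v xP vQ|H k l x y xP Qy].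
  by apply: H => //; rewrite -conjtrM vQ conjtr0.
rewrite -[y]conjtrK; apply: H => //.
by rewrite -[LHS]conjtrK conjtrM conjtrK Qy conjtr0.
Qed.

Section BorderedRanks.

Variables (m p q s t : nat).
Variables (A : 'M[F]_(m, p)) (B : 'M[F]_(m, q)) (C : 'M[F]_(s, p)) (D : 'M[F]_(t, p)).
Variables (Phi : 'M[F]_m) (Psi : 'M[F]_s) (Omega : 'M[F]_t).

Lemma rk_bordered_AB :
  rk (col_mx (row_mx Phi (row_mx A B)) (row_mx B^H (row_mx 0 0)))
    = (rk (row_mx A B) + rk B)%N <->
  forall k l (x : 'M_(k, m)) (x' : 'M_(l, m)),
    x *m A = 0 -> x *m B = 0 -> x' *m B = 0 -> x *m Phi *m x'^H = 0.
Proof.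
rewrite row_mx0 rk_bordered; split=> H k l x x'; last first.
  by rewrite mul_mx_row -row_mx0 => /eq_row_mx[xA xB]; exact: H.
by move=> xA xB; apply: H; rewrite mul_mx_row xA xB row_mx0.
Qed.

(** The borders are [P] and [P^H], whence the factor two. The sign of [Psi] turns vanishing of the
    block form on the kernel of [P] into equality of two forms. *)
Lemma rk_bordered_ABC :
  rk (col_mx (row_mx Phi  (row_mx 0       (row_mx A B)))
     (col_mx (row_mx 0    (row_mx (- Psi) (row_mx C 0)))
     (col_mx (row_mx A^H  (row_mx C^H     (row_mx 0 0)))
             (row_mx B^H  (row_mx 0       (row_mx 0 0))))))
    = (2 * rk (col_mx (row_mx A B) (row_mx C 0)))%N <->
  forall k l (x : 'M_(k, m)) (y : 'M_(k, s)) (x' : 'M_(l, m)) (y' : 'M_(l, s)),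
    x *m A + y *m C = 0 -> x *m B = 0 -> x' *m A + y' *m C = 0 -> x' *m B = 0 ->
    x *m Phi *m x'^H = y *m Psi *m y'^H.
Proof.
set P := col_mx (row_mx A B) _.
rewrite mul2n -addnn (col_mx_row_mx A^H) (col_mx_row_mx C^H) !row_mx0 !col_mx0 rk_block_mxA //.
have -> : row_mx (col_mx A^H B^H) (col_mx C^H 0) = P^H.
  by rewrite conjtr_col_mx !conjtr_row_mx conjtr0.
have xP k (x : 'M_(k, m)) (y : 'M_(k, s)) :
    row_mx x y *m P = row_mx (x *m A + y *m C) (x *m B).
  by rewrite mul_row_col !mul_mx_row mulmx0 add_row_mx addr0.
have form k l (x : 'M_(k, m)) (y : 'M_(k, s)) (x' : 'M_(l, m)) (y' : 'M_(l, s)) :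
    row_mx x y *m block_mx Phi 0 0 (- Psi) *m (row_mx x' y')^H =
    x *m Phi *m x'^H - y *m Psi *m y'^H.
  by rewrite mul_row_block !mulmx0 addr0 add0r conjtr_row_mx mul_row_col mulmxN mulNmx.
rewrite rk_bordered; split=> [H k l x y x' y' xA xB xA' xB'|H k l x x'].
  by apply/eqP; rewrite -subr_eq0 -form H // xP ?(xA, xB, xA', xB') row_mx0.
rewrite -[x]hsubmxK -[x']hsubmxK !xP -!row_mx0 => /eq_row_mx[xA xB] /eq_row_mx[xA' xB'].
by rewrite form (H _ _ _ _ _ _ xA xB xA' xB') subrr.
Qed.

Lemma rk_bordered_CD :
  rk (col_mx (row_mx Psi (row_mx 0         C))
     (col_mx (row_mx 0   (row_mx (- Omega) D))
             (row_mx C^H (row_mx D^H       0))))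
    = (2 * rk (col_mx C D))%N <->
  forall k l (y : 'M_(k, s)) (z : 'M_(k, t)) (y' : 'M_(l, s)) (z' : 'M_(l, t)),
    y *m C + z *m D = 0 -> y' *m C + z' *m D = 0 ->
    y *m Psi *m y'^H = z *m Omega *m z'^H.
Proof.
rewrite mul2n -addnn rk_block_mxA // -conjtr_col_mx.
have form k l (x : 'M_(k, s)) (y : 'M_(k, t)) (x' : 'M_(l, s)) (y' : 'M_(l, t)) :
    row_mx x y *m block_mx Psi 0 0 (- Omega) *m (row_mx x' y')^H =
    x *m Psi *m x'^H - y *m Omega *m y'^H.
  by rewrite mul_row_block !mulmx0 addr0 add0r conjtr_row_mx mul_row_col mulmxN mulNmx.
rewrite rk_bordered; split=> [H k l y z y' z' yC yC'|H k l y y'].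
  by apply/eqP; rewrite -subr_eq0 -form H // mul_row_col.
rewrite -[y]hsubmxK -[y']hsubmxK form 2!mul_row_col => yC yC'.
by rewrite (H _ _ _ _ _ _ yC yC') subrr.
Qed.

(** The two borders differ: kernel vectors of [P] put [x A] in the row spaces of both [C] and [D],
    those of [Q] put [x' A] only in their sum. *)
Lemma rk_bordered_ABCD :
  rk (col_mx (row_mx Phi (row_mx 0       (row_mx 0         (row_mx A (row_mx A B)))))
     (col_mx (row_mx 0   (row_mx (- Psi) (row_mx 0         (row_mx C (row_mx 0 0)))))
     (col_mx (row_mx 0   (row_mx 0       (row_mx (- Omega) (row_mx 0 (row_mx D 0)))))
     (col_mx (row_mx A^H (row_mx C^H     (row_mx D^H       (row_mx 0 (row_mx 0 0)))))
             (row_mx B^H (row_mx 0       (row_mx 0         (row_mx 0 (row_mx 0 0)))))))))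
    = (rk (col_mx (row_mx A (row_mx A B))
          (col_mx (row_mx C (row_mx 0 0))
                  (row_mx 0 (row_mx D 0))))
       + rk (col_mx (row_mx A B) (col_mx (row_mx C 0) (row_mx D 0))))%N <->
  forall k l (x : 'M_(k, m)) (y : 'M_(k, s)) (z : 'M_(k, t))
             (x' : 'M_(l, m)) (y' : 'M_(l, s)) (z' : 'M_(l, t)),
    x *m A + y *m C = 0 -> x *m A + z *m D = 0 -> x *m B = 0 ->
    x' *m A + y' *m C + z' *m D = 0 -> x' *m B = 0 ->
    x *m Phi *m x'^H = y *m Psi *m y'^H + z *m Omega *m z'^H.
Proof.
rewrite (col_mx_row_mx A^H) (col_mx_row_mx C^H) (col_mx_row_mx D^H) !row_mx0 !col_mx0.
rewrite rk_bordered_diag3 // [rk (col_mx _ (col_mx (row_mx C 0) _))]rk_col_mxA //.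
rewrite [rk (col_mx _ (col_mx (row_mx C 0) _))]rk_col_mxA //.
set P := col_mx (col_mx (row_mx A (row_mx A B)) _) _.
set Q := col_mx (col_mx (row_mx A B) _) _.
have -> : row_mx (row_mx (col_mx A^H B^H) (col_mx C^H 0)) (col_mx D^H 0) = Q^H.
  by rewrite !conjtr_col_mx !conjtr_row_mx !conjtr0.
have xP k (x : 'M_(k, m)) (y : 'M_(k, s)) (z : 'M_(k, t)) :
    row_mx (row_mx x y) z *m P =
    row_mx (x *m A + y *m C) (row_mx (x *m A + z *m D) (x *m B)).
  by rewrite !mul_row_col !mul_mx_row !mulmx0 -row_mx0 !add_row_mx !addr0.
have xQ k (x : 'M_(k, m)) (y : 'M_(k, s)) (z : 'M_(k, t)) :
    row_mx (row_mx x y) z *m Q = row_mx (x *m A + y *m C + z *m D) (x *m B).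
  by rewrite !mul_row_col !mul_mx_row !mulmx0 !add_row_mx !addr0.
have form k l (x : 'M_(k, m)) (y : 'M_(k, s)) (z : 'M_(k, t))
    (x' : 'M_(l, m)) (y' : 'M_(l, s)) (z' : 'M_(l, t)) :
    row_mx (row_mx x y) z *m block_mx (block_mx Phi 0 0 (- Psi)) 0 0 (- Omega) *m
      (row_mx (row_mx x' y') z')^H =
    x *m Phi *m x'^H - (y *m Psi *m y'^H + z *m Omega *m z'^H).
  rewrite !mul_row_block !mulmx0 !addr0 !add0r !conjtr_row_mx !mul_row_col.
  by rewrite !mulmxN !mulNmx opprD addrA.
rewrite rk_bordered; split=> [H k l x y z x' y' z' xC xD xB xA' xB'|H k l x x'].
  by apply/eqP; rewrite -subr_eq0 -form H // ?xP ?xQ ?(xC, xD, xB, xA', xB') ?row_mx0.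
rewrite -[x]hsubmxK -[lsubmx x]hsubmxK -[x']hsubmxK -[lsubmx x']hsubmxK form xP xQ -!row_mx0.
move=> /eq_row_mx[xC /eq_row_mx[xD xB]] /eq_row_mx[xA' xB'].
by rewrite (H _ _ _ _ _ _ _ _ xC xD xB xA' xB') subrr.
Qed.

End BorderedRanks.

End Hermitian.

(** * Passage between the system and the rank equalities *)

Theorem theorem3p6 (F : unitRingType) (star : F -> F)
  (divF : division_ring F)
  (starP : involutive_antiautomorphism star)
  (char_neq2 : 2%N \notin [pchar F])
  (m p q s t : nat)
  (A : 'M[F]_(m, p)) (B : 'M[F]_(m, q)) (C : 'M[F]_(s, p)) (D : 'M[F]_(t, p))
  (Phi : 'M[F]_m) (Psi : 'M[F]_s) (Omega : 'M[F]_t)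
  (Phi_herm : Phi = conjtr star Phi)
  (Psi_herm : Psi = conjtr star Psi)
  (Omega_herm : Omega = conjtr star Omega) :
  (exists (X : 'M[F]_p) (Y : 'M[F]_(q, m)),
     [/\ A *m X *m conjtr star A + B *m Y + conjtr star (B *m Y) = Phi,
         C *m X *m conjtr star C = Psi,
         D *m X *m conjtr star D = Omega
       & X = conjtr star X])
  <->
  (rk (col_mx (row_mx Phi             (row_mx A B))
              (row_mx (conjtr star B) (row_mx 0 0)))
     = rk (row_mx A B) + rk B)%N
  /\ rk (row_mx C Psi) = rk C
  /\ rk (row_mx D Omega) = rk D
  /\ rk (col_mx (row_mx Phi             (row_mx 0               (row_mx A B)))
        (col_mx (row_mx 0               (row_mx (- Psi)         (row_mx C 0)))
        (col_mx (row_mx (conjtr star A) (row_mx (conjtr star C) (row_mx 0 0)))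
                (row_mx (conjtr star B) (row_mx 0               (row_mx 0 0))))))
     = (2 * rk (col_mx (row_mx A B)
                       (row_mx C 0)))%N
  /\ rk (col_mx (row_mx Phi             (row_mx 0               (row_mx A B)))
        (col_mx (row_mx 0               (row_mx (- Omega)       (row_mx D 0)))
        (col_mx (row_mx (conjtr star A) (row_mx (conjtr star D) (row_mx 0 0)))
                (row_mx (conjtr star B) (row_mx 0               (row_mx 0 0))))))
     = (2 * rk (col_mx (row_mx A B)
                       (row_mx D 0)))%N
  /\ rk (col_mx (row_mx Psi             (row_mx 0               C))
        (col_mx (row_mx 0               (row_mx (- Omega)       D))
                (row_mx (conjtr star C) (row_mx (conjtr star D) 0))))
     = (2 * rk (col_mx C D))%N
  /\ rk (col_mx (row_mx Phi (row_mx 0       (row_mx 0         (row_mx A (row_mx A B)))))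
        (col_mx (row_mx 0   (row_mx (- Psi) (row_mx 0         (row_mx C (row_mx 0 0)))))
        (col_mx (row_mx 0   (row_mx 0       (row_mx (- Omega) (row_mx 0 (row_mx D 0)))))
        (col_mx (row_mx (conjtr star A)
                            (row_mx (conjtr star C)
                                            (row_mx (conjtr star D)
                                                              (row_mx 0 (row_mx 0 0)))))
                (row_mx (conjtr star B)
                            (row_mx 0       (row_mx 0         (row_mx 0 (row_mx 0 0)))))))))
     = (rk (col_mx (row_mx A (row_mx A B))
           (col_mx (row_mx C (row_mx 0 0))
                   (row_mx 0 (row_mx D 0))))
        + rk (col_mx (row_mx A B)
             (col_mx (row_mx C 0)
                     (row_mx D 0))))%N.
Proof.
have conjH := conjtrM starP.
split=> [[X [Y [eqPhi eqPsi eqOmega hX]]]|].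
  (* Vectors killing [B] remove both terms in [Y], leaving the form of [X] on the rows of [A]. *)
  have PhiE k l (x : 'M_(k, m)) (x' : 'M_(l, m)) : x *m B = 0 -> x' *m B = 0 ->
      x *m Phi *m (conjtr star x') = x *m A *m X *m conjtr star (x' *m A).
    move=> xB xB'; rewrite -eqPhi !mulmxDr !mulmxDl !conjH !mulmxA xB !mul0mx addr0.
    by rewrite -[X in _ + X]mulmxA -conjH xB' conjtr0 // mulmx0 addr0.
  have PsiE k l (y : 'M_(k, s)) (y' : 'M_(l, s)) :
      y *m Psi *m conjtr star y' = y *m C *m X *m conjtr star (y' *m C).
    by rewrite -eqPsi conjH !mulmxA.
  have OmegaE k l (z : 'M_(k, t)) (z' : 'M_(l, t)) :
      z *m Omega *m conjtr star z' = z *m D *m X *m conjtr star (z' *m D).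
    by rewrite -eqOmega conjH !mulmxA.
  have sub0 n k (U V : 'M[F]_(k, n)) : U + V = 0 -> V = - U.
    by move/eqP; rewrite addrC addr_eq0 => /eqP.
  (* Negating both arguments leaves a form unchanged, which absorbs the signs of the kernel
     relations. *)
  have oppE k l (u : 'M_(k, p)) (u' : 'M_(l, p)) :
      (- u) *m X *m conjtr star (- u') = u *m X *m conjtr star u'.
    by rewrite conjtrN // mulmxN !mulNmx opprK.
  do !split.
  - apply/rk_bordered_AB => // k l x x' xA xB xB'.
    by rewrite PhiE // xA !mul0mx.
  - by apply/rk_row_mx_eql => // k y yC; rewrite -eqPsi !mulmxA yC !mul0mx.
  - by apply/rk_row_mx_eql => // k z zD; rewrite -eqOmega !mulmxA zD !mul0mx.
  - apply/rk_bordered_ABC => // k l x y x' y' xA xB xA' xB'.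
    by rewrite PhiE // PsiE (sub0 _ _ _ _ xA) (sub0 _ _ _ _ xA') oppE.
  - apply/rk_bordered_ABC => // k l x y x' y' xA xB xA' xB'.
    by rewrite PhiE // OmegaE (sub0 _ _ _ _ xA) (sub0 _ _ _ _ xA') oppE.
  - apply/rk_bordered_CD => // k l y z y' z' yC yC'.
    by rewrite PsiE OmegaE (sub0 _ _ _ _ yC) (sub0 _ _ _ _ yC') oppE.
  - apply/rk_bordered_ABCD => // k l x y z x' y' z' xC xD xB xA' xB'.
    rewrite PhiE // PsiE OmegaE (sub0 _ _ _ _ xC) (sub0 _ _ _ _ xD) !mulNmx -!mulmxN.
    rewrite -mulmxDr -!conjtrN // -conjtrD //; congr (_ *m conjtr star _).
    by move/eqP: xA'; rewrite -addrA addr_eq0 opprD => /eqP.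
move=> [/(rk_bordered_AB divF starP) rAB [/(rk_row_mx_eql divF) rC [/(rk_row_mx_eql divF) rD]]].
move=> [/(rk_bordered_ABC divF starP) rABC [/(rk_bordered_ABC divF starP) rABD]].
move=> [/(rk_bordered_CD divF starP) rCD /(rk_bordered_ABCD divF starP) rABCD].
have [N [NB kerB]] := left_kernel divF B.
have xNB k (x : 'M_(k, m)) : x *m N *m B = 0 by rewrite -mulmxA NB mulmx0.
have formN k l (x : 'M_(k, m)) (x' : 'M_(l, m)) :
    x *m (N *m Phi *m conjtr star N) *m conjtr star x'
    = x *m N *m Phi *m conjtr star (x' *m N).
  by rewrite conjH !mulmxA.
have oppform n k l (y : 'M_(k, n)) (y' : 'M_(l, n)) (P : 'M_n) :
    - y *m P *m conjtr star (- y') = y *m P *m conjtr star y'.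
  by rewrite conjtrN // mulmxN !mulNmx opprK.
have [X [hX NXN CXC DXD]] : exists X : 'M[F]_p,
    [/\ X = conjtr star X,
        N *m A *m X *m conjtr star (N *m A) = N *m Phi *m conjtr star N,
        C *m X *m conjtr star C = Psi & D *m X *m conjtr star D = Omega].
  (* With [N A] in place of [A], the first three rank equalities make the forms well defined and the
     other four supply the agreements. *)
  apply: three_congruence_equations => //.
  - by rewrite !conjH conjtrK // -Phi_herm mulmxA.
  - by move=> k x xA; rewrite !mulmxA; apply: rAB; rewrite // -mulmxA.
  - move=> k x y xA; rewrite formN -[RHS]oppform.
    by apply: rABC; rewrite // mulNmx -xA mulmxA subrr.
  - move=> k x z xA; rewrite formN -[RHS]oppform.
    by apply: rABD; rewrite // mulNmx -xA mulmxA subrr.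
  - move=> k y z yC; rewrite -[RHS]oppform.
    by apply: rCD; rewrite // mulNmx -yC subrr.
  - move=> k l x y z x' y' z' xC xD xA'.
    rewrite formN -[X in X + _]oppform -[X in _ + X]oppform.
    apply: rABCD => //; rewrite -(mulmxA _ N A) ?mulNmx ?xC ?xD ?xA' ?subrr //.
      by rewrite -xC xD subrr.
    by rewrite -addrA -opprD subrr.
have hS : Phi - A *m X *m conjtr star A = conjtr star (Phi - A *m X *m conjtr star A).
  by rewrite conjtrB // !conjH conjtrK // -Phi_herm -hX mulmxA.
(* By the choice of [X], compressing the residue [Phi - A X A^H] by [N] gives zero, the solvability
   condition for [Y]. *)
have [|Y BY] := B_plus_Bstar divF starP char_neq2 hS kerB.
  rewrite mulmxBr mulmxBl -NXN conjH !mulmxA subrr //.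
exists X, Y; split=> //.
by rewrite -addrA BY addrC subrK.
Qed.
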